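(* Let $\lambda$ be either RP or CP, and let $k>m>0$ be integers. Let $Z$ and $Y$ be metric spaces, $\phi:Z\to Y$ a map of sets, and $X\subseteq Z$ a subspace such that the restriction $\phi_X=\phi|_X:X\to Y$ is a surjection. Let $\Gamma$ be a collection of subsets of $Z$ of cardinality $k$ through $k-m-1$ (i.e. with cardinalities in $\{k,k-1,\dots,k-m-1\}$) satisfying the following two properties: ($X$-covering property) for every pair of points $\{x_1,x_2\}$ in $X$ there is a subset $S\in\Gamma$ such that $|S|=k$ and $\{x_1,x_2\}\subset S$; (Closure property) if $S\in\Gamma$ has $|S|=k$, and $S'\subset S$ has $|S'|\ge k-m-1$, then $S'\in\Gamma$. Suppose that $d_B(\lambda^m(S),\lambda^m(\phi(S)))\le\epsilon$ for all $S\in\Gamma$. If $\lambda$ is RP, then $\phi_X$ is a $112k^2\epsilon$ quasi-isometry, and if $\lambda$ is CP, then $\phi_X$ is a $224\,S(k,m)\,\epsilon$ quasi-isometry, where $$S(k,m)=\binom{k}{2}+\binom{k}{3}+\cdots+\binom{k}{m+1}.$$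
   Context: A map $\psi:(A,d_A)\to(B,d_B)$ of metric spaces is a $c$ quasi-isometry if $|d_A(a_1,a_2)-d_B(\psi(a_1),\psi(a_2))|\le c$ for all $a_1,a_2\in A$. For a metric space $(W,d)$, let $K(W)$ be the simplicial complex of all nonempty finite subsets of $W$. The Rips filtration function is $f(\sigma)=\max_{x,y\in\sigma}d(x,y)$. For the Čech filtration, $W$ is given as a subspace of an ambient metric space $E$ (e.g. $E=\mathbb{R}^d$ for a Euclidean point cloud) and $f(\sigma)=2\inf_{c\in E}\max_{x\in\sigma}d(c,x)$, where $E$ is such that an edge $\{x,y\}$ has $f(\{x,y\})=d(x,y)$. In either case $f(\sigma)$ depends only on $\sigma$. For a finite $S\subseteq W$, $K^m(S)$ is the $m$-skeleton of the complex of simplices contained in $S$, filtered by the sublevel sets $\{\sigma: f(\sigma)\le r\}$. $\lambda^m(S)$ is the collection of persistence diagrams, in every homological degree (field coefficients), of the filtered complex $K^m(S)$, using the Rips filtration if $\lambda=$ RP (Rips persistence) and the Čech filtration if $\lambda=$ CP (Čech persistence). $d_B$ is the bottleneck distance (with $\ell^\infty$ ground metric, points may be matched to the diagonal), maximized over all homological degrees. *)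

(* Defs.v *)
From HB Require Import structures.
From mathcomp Require Import all_boot all_order all_algebra.
From mathcomp Require Import finmap.
From mathcomp Require Import all_classical all_reals.
From mathcomp Require Import ereal topology metric_structure.

Set Implicit Arguments.
Unset Strict Implicit.
Unset Printing Implicit Defensive.

Import Order.TTheory GRing.Theory Num.Theory.

Local Open Scope classical_set_scope.
Local Open Scope ring_scope.

(* The vertices form a finite type [T], a simplex is a set of vertices, and a
   complex is a set of simplices.  A chain is a function on all of {set T};
   those of a complex are cut out as subspaces.  Orientations come from the
   ordering of [T] by [enum_rank]. *)

Section Homology.
Variables (F : fieldType) (T : finType).

Definition chain := {ffun {set T} -> F^o}.

Definition elem_chain (s : {set T}) : chain := [ffun t => (t == s)%:R].

(* The sign of the face [t] of [v |: t], for [v \notin t]. *)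
Definition face_sign (v : T) (t : {set T}) : F :=
  (-1) ^+ #|[set w in t | (enum_rank w < enum_rank v)%N]|.

(* Unreduced: the boundary of a vertex is 0. *)
Definition boundary_fun (c : chain) : chain :=
  [ffun t => if t == finset.set0 then 0
             else \sum_(v | v \notin t) face_sign v t * c (v |: t)%SET].

Fact boundary_fun_linear : linear boundary_fun.
Proof.
move=> a c c'; apply/ffunP => t; rewrite !ffunE.
case: ifP => _; first by rewrite scaler0 addr0.
rewrite scaler_sumr -big_split /=; apply: eq_bigr => v _.
by rewrite !ffunE mulrDr /GRing.scale /= mulrCA.
Qed.

HB.instance Definition _ :=
  GRing.isLinear.Build F chain chain *:%R boundary_fun boundary_fun_linear.

Definition boundary : 'End(chain) := linfun boundary_fun.

Definition chains (K : {set {set T}}) (p : nat) : {vspace chain} :=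
  <<[seq elem_chain s | s : {set T} <- enum K & #|s| == p.+1]>>%VS.

Definition cycles (K : {set {set T}}) (p : nat) : {vspace chain} :=
  (chains K p :&: lker boundary)%VS.

Definition boundaries (K : {set {set T}}) (p : nat) : {vspace chain} :=
  (boundary @: chains K p.+1)%VS.

(* The rank of H_p(K) -> H_p(L) for a subcomplex [K] of [L]: its image is
   Z_p(K) / (Z_p(K) :&: B_p(L)). *)
Definition homology_rank (p : nat) (K L : {set {set T}}) : nat :=
  (\dim (cycles K p) - \dim (cycles K p :&: boundaries L p))%N.

End Homology.

Section Diagram.
Variables (R : realType) (F : fieldType) (T : finType).
Variables (K : {set {set T}}) (f : {set T} -> R) (p : nat).

Definition sublevel (r : R) : {set {set T}} := [set s in K | f s <= r]%SET.
Definition sublevel_lt (r : R) : {set {set T}} := [set s in K | f s < r]%SET.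

Definition critical_values : seq R := undup [seq f s | s <- enum K].

(* With critical values a_1 < ... < a_n and beta(i,j) the rank of
   H_p(K_{a_i}) -> H_p(K_{a_j}), the multiplicity of (a_i, a_j) is
     (beta(i,j-1) - beta(i,j)) - (beta(i-1,j-1) - beta(i-1,j));
   the complex at a_{i-1} is the strict sublevel complex at a_i.  For b < d
   all three natural-number subtractions are exact. *)
Definition multiplicity (b d : R) : nat :=
  if b < d then
    ((homology_rank F p (sublevel b) (sublevel_lt d)
        - homology_rank F p (sublevel b) (sublevel d))
     - (homology_rank F p (sublevel_lt b) (sublevel_lt d)
        - homology_rank F p (sublevel_lt b) (sublevel d)))%N
  else 0%N.

Definition multiplicity_oo (b : R) : nat :=
  (homology_rank F p (sublevel b) K
     - homology_rank F p (sublevel_lt b) K)%N.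

(* A list of (birth, death) pairs, repeated according to multiplicity; the
   points on the diagonal are left out. *)
Definition persistence_diagram : seq (R * \bar R) :=
  flatten [seq nseq (multiplicity b d) (b, d%:E)
          | b <- critical_values, d <- critical_values]
  ++ flatten [seq nseq (multiplicity_oo b) (b, +oo%E) | b <- critical_values].

End Diagram.

Section Bottleneck.
Variable R : realType.
Local Open Scope ereal_scope.

(* In the library +oo - +oo is infinite, whereas two essential classes are at
   distance 0 in the death coordinate. *)
Definition death_dist (x y : \bar R) : \bar R :=
  if x == y then 0 else `|x - y|.

Definition point_dist (u v : R * \bar R) : \bar R :=
  maxe `|u.1 - v.1|%R%:E (death_dist u.2 v.2).

Definition diagonal_dist (u : R * \bar R) : \bar R :=
  (u.2 - u.1%:E) * (2^-1)%:E.

Section Matchings.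
Variables D D' : seq (R * \bar R).

(* [M i = Some j] matches the i-th point of [D] with the j-th point of [D'];
   unmatched points of either diagram go to the diagonal. *)
Definition is_matching (M : 'I_(size D) -> option 'I_(size D')) : Prop :=
  forall i i' j, M i = Some j -> M i' = Some j -> i = i'.

Definition matching_cost (M : 'I_(size D) -> option 'I_(size D')) : \bar R :=
  maxe
    (\big[maxe/0]_(i < size D)
       match M i with
       | Some j => point_dist (tnth (in_tuple D) i) (tnth (in_tuple D') j)
       | None => diagonal_dist (tnth (in_tuple D) i)
       end)
    (\big[maxe/0]_(j < size D' | [forall i, M i != Some j])
       diagonal_dist (tnth (in_tuple D') j)).

Definition bottleneck : \bar R :=
  ereal_inf [set matching_cost M | M in is_matching].

End Matchings.

Definition graded_bottleneck (D D' : nat -> seq (R * \bar R)) : \bar R :=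
  ereal_sup [set bottleneck (D p) (D' p) | p in [set: nat]].

End Bottleneck.

Section Filtrations.
Variables (R : realType) (W : metricType R).

Definition rips (s : {fset W}) : R :=
  \big[Num.max/0]_(x <- s) \big[Num.max/0]_(y <- s) mdist x y.

(* The inclusion of the points into the ambient space is a map [i : W -> E]. *)
Definition cech (E : metricType R) (i : W -> E) (s : {fset W}) : R :=
  2 * inf [set \big[Num.max/0]_(x <- s) mdist c (i x) | c in [set: E]].

Definition cech_ambient (E : metricType R) (i : W -> E) : Prop :=
  (forall x y, mdist (i x) (i y) = mdist x y) /\
  (forall x y, cech i [fset x; y]%fset = mdist x y).

Definition skeleton (T : finType) (m : nat) : {set {set T}} :=
  [set s : {set T} | (0 < #|s| <= m.+1)%N]%SET.

Definition persistence (F : fieldType) (m : nat) (f : {fset W} -> R)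
    (S : {fset W}) (p : nat) : seq (R * \bar R) :=
  persistence_diagram F (skeleton S m)
    (fun s : {set S} => f [fset val x | x in s]%fset) p.

Definition RP (F : fieldType) (m : nat) (S : {fset W}) :=
  persistence F m rips S.

Definition CP (F : fieldType) (m : nat) (E : metricType R) (i : W -> E)
    (S : {fset W}) :=
  persistence F m (cech i) S.

End Filtrations.

Section QuasiIsometry.
Variables (R : realType) (A B : metricType R).

Definition quasi_isometry_on (X : set A) (psi : A -> B) (c : R) : Prop :=
  forall a1 a2, X a1 -> X a2 ->
    `|mdist a1 a2 - mdist (psi a1) (psi a2)| <= c.

End QuasiIsometry.

Section Collections.
Variable Z : choiceType.

Definition covering_property (k : nat) (X : set Z) (G : set {fset Z}) : Prop :=
  forall x1 x2, X x1 -> X x2 ->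
    exists S, [/\ G S, #|` S| = k, x1 \in S & x2 \in S].

Definition closure_property (k m : nat) (G : set {fset Z}) : Prop :=
  forall S S' : {fset Z}, G S -> #|` S| = k ->
    (S' `<=` S)%fset -> (k - m - 1 <= #|` S'|)%N -> G S'.

End Collections.

(* Main.v *)
Require Import Defs.
From HB Require Import structures.
From mathcomp Require Import all_boot all_order all_algebra.
From mathcomp Require Import finmap.
From mathcomp Require Import all_classical all_reals.
From mathcomp Require Import ereal topology metric_structure.
From mathcomp Require Import zify ring lra.

Set Implicit Arguments.
Unset Strict Implicit.
Unset Printing Implicit Defensive.

Import Order.TTheory GRing.Theory Num.Theory.

Local Open Scope classical_set_scope.
Local Open Scope ring_scope.

(* Alternating sums of Betti numbers turn the diagrams of a filtered complex
   into the Euler characteristics of its sublevel complexes.  If a level [u] is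
   such that no filtration value of [S] or [phi S] lies in (u, u + 2 eps], an
   eps-matching preserves the number of intervals containing [u], so both
   sublevel complexes at [u] have the same Euler characteristic.  At a large
   level this forces [phi] to be injective on [S] as soon as [k > m + 1]; then
   inclusion-exclusion over the subsets [S \ T] with [#|T| <= m + 1] shows that
   every simplex [s] of dimension at most [m] satisfies [f s <= u] iff
   [f (phi s) <= u].  If d(x, y) and d(phi x, phi y) differed by more than
   2 eps times the number of filtration values, some such [u] would separate
   them.  When [k = m + 1], all subsets of [S] are in [Gamma], and the argument
   applies to the pair {x, y}, which [phi] may collapse to a point. *)

(** * Boundary operator and the Euler-Poincare formula *)

Section ChainComplex.
Variables (F : fieldType) (T : finType).
Implicit Types (K L : {set {set T}}) (p : nat) (c : chain F T) (s t : {set T}).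

Lemma elem_chain_free (e : seq {set T}) :
  uniq e -> free [seq elem_chain F s | s <- e].
Proof.
move=> ue; rewrite -[X in free X]/(tval (in_tuple _)); apply/freeP => a a0 i.
have szi : (i < size e)%N by rewrite -(size_map (@elem_chain F T)).
have /ffunP/(_ (nth finset.set0 e i)) := a0.
rewrite ffunE sum_ffunE (bigD1 i) //= big1 ?addr0 => [|j jNi].
  by rewrite !ffunE (nth_map finset.set0) // ffunE eqxx /GRing.scale /= mulr1.
have szj : (j < size e)%N by rewrite -(size_map (@elem_chain F T)).
rewrite !ffunE (nth_map finset.set0) // ffunE nth_uniq // eq_sym.
by rewrite (negbTE (jNi : (j : nat) != i)) scaler0.
Qed.

Lemma dim_chains K p : \dim (chains F K p) = #|[set s in K | #|s| == p.+1]%SET|.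
Proof.
rewrite /chains.
have /eqP -> : free [seq elem_chain F s | s : {set T} <- enum K & #|s| == p.+1].
  by apply/elem_chain_free/filter_uniq/enum_uniq.
rewrite size_map cardE /enum_mem -filter_predI; congr size.
by apply: eq_filter => s; rewrite /= !inE andbC.
Qed.

Lemma mem_chains K p c :
  reflect (forall t, c t != 0 -> (t \in K) && (#|t| == p.+1))
          (c \in chains F K p).
Proof.
apply: (iffP idP) => [/(@coord_span _ _ _ (in_tuple _)) -> t | cK].
  apply: contraR => tNK; rewrite sum_ffunE big1 // => i _.
  rewrite ffunE; set e := in_tuple _.
  have /mapP[s] : e`_i \in [seq elem_chain F s | s : {set T} <- enum K & #|s| == p.+1].
    by rewrite mem_nth.
  rewrite mem_filter mem_enum andbC => sK ->; rewrite ffunE.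
  case: eqP => [ts|_]; last by rewrite scaler0.
  by rewrite ts sK in tNK.
have -> : c = \sum_s c s *: elem_chain F s.
  apply/ffunP => t; rewrite sum_ffunE (bigD1 t) //= !ffunE eqxx /GRing.scale /=.
  rewrite mulr1 big1 ?addr0 // => s; rewrite eq_sym => /negbTE st.
  by rewrite !ffunE st; exact: mulr0.
apply: memv_suml => s _; have [->|cs] := eqVneq (c s) 0.
  by rewrite scale0r mem0v.
apply/memvZ/memv_span/map_f; rewrite mem_filter mem_enum andbC; exact: cK.
Qed.

Lemma boundaryE c t : boundary F T c t =
  if t == finset.set0 then 0
  else \sum_(v | v \notin t) face_sign F v t * c (v |: t)%SET.
Proof. by rewrite lfunE ffunE. Qed.

(** The sign counts the vertices before the inserted one: adding the smaller vertex shifts the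
    position of the larger by one, while adding the larger leaves the smaller in place. This is the
    source of the cancellation in [boundary_boundary]. *)
Lemma face_sign_lt (v w : T) t : v \notin t -> w \notin t ->
  (enum_rank v < enum_rank w)%N ->
  face_sign F w (v |: t)%SET = - face_sign F w t /\
  face_sign F v (w |: t)%SET = face_sign F v t.
Proof.
move=> vt wt vw; split; rewrite /face_sign.
  have -> : [set x in v |: t | (enum_rank x < enum_rank w)%N]%SET
     = (v |: [set x in t | (enum_rank x < enum_rank w)%N])%SET.
    by apply/setP => x; rewrite !inE; case: eqP => //= ->; rewrite vw.
  by rewrite cardsU1 !inE (negbTE vt) /= exprS mulN1r.
congr (_ ^+ #|pred_of_set _|); apply/setP => x; rewrite !inE.
case: eqP => //= ->; rewrite (negbTE wt) /=.
by apply/negbTE; rewrite -leqNgt ltnW.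
Qed.

Lemma boundary_boundary c : boundary F T (boundary F T c) = 0.
Proof.
apply/ffunP => t; rewrite boundaryE ffunE; case: ifPn => // _.
pose A v w : F := face_sign F v t * face_sign F w (v |: t)%SET * c (w |: (v |: t))%SET.
transitivity (\sum_(v | v \notin t) \sum_(w | (w \notin t) && (w != v)) A v w).
  apply: eq_bigr => v vt; rewrite boundaryE.
  have /negbTE -> : (v |: t != finset.set0)%SET.
    by apply/set0Pn; exists v; rewrite !inE eqxx.
  rewrite mulr_sumr; apply: eq_big => [w|w _]; last by rewrite /A mulrA.
  by rewrite !inE negb_or andbC.
pose lt (v w : T) := (enum_rank v < enum_rank w)%N.
(* Every pair of missing vertices is inserted in both orders; splitting by rank and exchanging the
   sums in one half puts the two opposite terms side by side. *)
have spl v : \sum_(w | (w \notin t) && (w != v)) A v w =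
    \sum_(w | w \notin t) (if lt v w then A v w else 0)
  + \sum_(w | w \notin t) (if lt w v then A v w else 0).
  rewrite -big_split /= big_mkcondr; apply: eq_bigr => w _; rewrite /lt.
  case: (ltngtP (enum_rank v) (enum_rank w)) => [vw|wv|vw].
  - by case: eqP => [E|]; [rewrite E ltnn in vw | rewrite addr0].
  - by case: eqP => [E|]; [rewrite E ltnn in wv | rewrite add0r].
  - by rewrite (enum_rank_inj (val_inj vw)) eqxx addr0.
rewrite (eq_bigr _ (fun v _ => spl v)) big_split /= [X in _ + X]exchange_big /=.
rewrite -big_split big1 // => v vt /=; rewrite -big_split big1 // => w wt /=.
case: ifP => [vw|_]; last by rewrite addr0.
rewrite /A; have [-> ->] := face_sign_lt vt wt vw.
have -> : (w |: (v |: t) = v |: (w |: t))%SET by rewrite finset.setUCA.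
by rewrite mulrN mulNr [face_sign F w t * _]mulrC addNr.
Qed.

Definition face_closed K := forall s t : {set T},
  s \in K -> t \subset s -> t != finset.set0 -> t \in K.

Lemma boundary_chains K p : face_closed K ->
  (boundaries F K p <= chains F K p)%VS.
Proof.
move=> Kcl; apply/subvP => _ /memv_imgP[c /mem_chains cK ->]; apply/mem_chains => t.
rewrite boundaryE; case: ifPn => [_|t0 sN0]; first by rewrite eqxx.
have [v vt cvt] : exists2 v, v \notin t & c (v |: t)%SET != 0.
  apply/exists_inP; apply: contraR sN0; rewrite negb_exists_in.
  move=> /forall_inP c0; apply/eqP/big1 => v /c0; rewrite negbK => /eqP ->.
  exact: mulr0.
have /andP[vK] := cK _ cvt; rewrite cardsU1 vt add1n eqSS => ->.
by rewrite (Kcl _ _ vK) // finset.subsetU1.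
Qed.

Lemma boundaries_sub_cycles K p : face_closed K ->
  (boundaries F K p <= cycles F K p)%VS.
Proof.
move=> Kcl; rewrite subv_cap boundary_chains //=.
apply/subvP => _ /memv_imgP[c _ ->].
by rewrite memv_ker boundary_boundary.
Qed.

(** The only proper face of a vertex is the empty set, where the boundary is 0 since homology is
    unreduced. *)
Lemma boundary_chains0 K : (boundary F T @: chains F K 0)%VS = 0%VS.
Proof.
apply/eqP; rewrite -subv0; apply/subvP => _ /memv_imgP[c /mem_chains cK ->].
rewrite memv0; apply/eqP/ffunP => t; rewrite boundaryE ffunE.
case: ifPn => // /set0Pn[x xt]; apply: big1 => v vt.
have [->|/cK] := eqVneq (c (v |: t)%SET) 0; first exact: mulr0.
by rewrite cardsU1 vt (cardsD1 x) xt andbF.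
Qed.

(** By rank-nullity the difference of the two sides is an alternating sum of [d p + d p.+1], which
    telescopes. The end terms vanish: vertices have boundary 0, and no simplex has more than [m.+1]
    vertices. *)
Lemma euler_poincare K m : face_closed K ->
  (forall s, s \in K -> (#|s| <= m.+1)%N) ->
  \sum_(p < m.+1) (-1) ^+ p *
     ((\dim (cycles F K p))%:Z - (\dim (boundaries F K p))%:Z)
  = \sum_(p < m.+1) (-1) ^+ p * (#|[set s in K | #|s| == p.+1]%SET|)%:Z.
Proof.
move=> Kcl Km.
pose d p := (\dim (boundary F T @: chains F K p)%VS)%:Z.
have zE p : (\dim (cycles F K p))%:Z =
    (#|[set s in K | #|s| == p.+1]%SET|)%:Z - d p.
  rewrite -dim_chains -(limg_ker_dim (boundary F T) (chains F K p)) /d /cycles.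
  by rewrite PoszD addrK.
have d0 : d 0%N = 0 by rewrite /d boundary_chains0 dimv0.
have dm : d m.+1 = 0.
  rewrite /d; have /eqP -> : chains F K m.+1 == 0%VS; last by rewrite limg0 dimv0.
  rewrite -dimv_eq0 dim_chains cards_eq0; apply/eqP/setP => s; rewrite !inE.
  by apply/negP => /andP[/Km sm /eqP sE]; rewrite sE ltnn in sm.
have tele n : \sum_(p < n) (-1) ^+ p * (d p + d p.+1) = - (-1) ^+ n * d n.
  elim: n => [|n IH]; first by rewrite big_ord0 d0 mulr0.
  by rewrite big_ord_recr /= IH exprS; ring.
apply/eqP; rewrite -subr_eq0 -sumrB; apply/eqP.
transitivity (- \sum_(p < m.+1) (-1) ^+ p * (d p + d p.+1)).
  rewrite -sumrN; apply: eq_bigr => p _; rewrite zE /boundaries -/(d p.+1); ring.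
by rewrite tele dm mulr0 oppr0.
Qed.

End ChainComplex.

(** * Counting the intervals of a diagram that contain a given level *)

Section DiagramCount.
Variables (R : realType) (F : fieldType) (T : finType).
Variables (K : {set {set T}}) (f : {set T} -> R) (p : nat).

Lemma critical_values_mem s : s \in K -> f s \in critical_values K f.
Proof. by move=> sK; rewrite mem_undup map_f // mem_enum. Qed.

(** The strict sublevel complex at a critical value is the sublevel complex at the preceding one, so
    the sum telescopes. The induction peels off the largest value satisfying [Q]. *)
Lemma sum_critical_values (g : {set {set T}} -> int) (Q : pred R) :
  (forall v w, w <= v -> Q v -> Q w) ->
  \sum_(v <- critical_values K f | Q v)
     (g (sublevel K f v) - g (sublevel_lt K f v))
  = g [set s in K | Q (f s)]%SET - g finset.set0.
Proof.
move: {2}_.+1 (ltnSn #|[set s in K | Q (f s)]%SET|) => n.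
elim: n Q => // n IH Q; rewrite ltnS => len Qdown.
have [A0|[s0 s0A]] := set_0Vmem [set s in K | Q (f s)]%SET.
  rewrite A0 subrr big_seq_cond big1 // => v /andP[].
  rewrite mem_undup => /mapP[s]; rewrite mem_enum => sK -> Qs.
  by have /setP/(_ s) := A0; rewrite !inE sK Qs.
have [s sA smax] := arg_maxP f s0A.
have /setIdP[sK Qs] : s \in [set s in K | Q (f s)]%SET := sA.
have -> : [set x in K | Q (f x)]%SET = sublevel K f (f s).
  apply/setP => x; rewrite !inE; case xK: (x \in K) => //=.
  apply/idP/idP => [Qx|xs]; last exact: Qdown xs Qs.
  by apply: smax; apply/setIdP.
rewrite -big_filter (bigD1_seq (f s)) ?filter_uniq ?undup_uniq //=; last first.
  by rewrite mem_filter Qs critical_values_mem.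
rewrite big_filter_cond.
have -> : \sum_(v <- critical_values K f | Q v && (v != f s))
     (g (sublevel K f v) - g (sublevel_lt K f v)) =
   \sum_(v <- critical_values K f | v < f s)
     (g (sublevel K f v) - g (sublevel_lt K f v)).
  rewrite big_seq_cond [RHS]big_seq_cond; apply: eq_bigl => v.
  rewrite mem_undup; case: mapP => //= -[x]; rewrite mem_enum => xK ->.
  rewrite lt_neqAle andbC; case: eqP => //= _.
  apply/idP/idP => [Qx|xs]; last exact: Qdown xs Qs.
  by apply: smax; apply/setIdP.
rewrite (IH (fun r => r < f s)) => [| |v w]; [ | | exact: le_lt_trans].
  by rewrite -/(sublevel_lt K f (f s)) addrA subrK.
apply: leq_trans len; apply: proper_card; apply/properP; split.
  apply/fintype.subsetP => x; rewrite !inE => /andP[-> /ltW xs] /=; exact: Qdown xs Qs.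
by exists s => //; rewrite !inE ltxx andbF.
Qed.

Let N (A B : {set {set T}}) := \dim (cycles F A p :&: boundaries F B p)%VS.

Lemma chainsS (A B : {set {set T}}) q : A \subset B ->
  (chains F A q <= chains F B q)%VS.
Proof.
move=> /fintype.subsetP AB; apply/subvP => c /mem_chains cA.
by apply/mem_chains => t /cA/andP[/AB -> ->].
Qed.

Lemma cyclesS (A B : {set {set T}}) q : A \subset B ->
  (cycles F A q <= cycles F B q)%VS.
Proof. by move=> AB; apply/capvS/subvv/chainsS. Qed.

(** Both mixed intersections lie in [U2 :&: V2] and meet inside [U1 :&: V1]. For cycles and
    boundaries this makes the truncated subtractions in the multiplicities exact. *)
Lemma dim_cap_submodular (V : vectType F) (U1 U2 V1 V2 : {vspace V}) :
  (U1 <= U2)%VS -> (V1 <= V2)%VS ->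
  (\dim (U1 :&: V2) + \dim (U2 :&: V1) <= \dim (U2 :&: V2) + \dim (U1 :&: V1))%N.
Proof.
move=> U12 V12; rewrite -dimv_sum_cap; apply: leq_add; apply: dimvS.
  by rewrite subv_add !capvS.
rewrite subv_cap (subv_trans (capvSl _ _) (capvSl _ _)).
by rewrite (subv_trans (capvSr _ _) (capvSr _ _)).
Qed.

Lemma sublevel_ltS r : sublevel_lt K f r \subset sublevel K f r.
Proof.
by apply/fintype.subsetP => s; rewrite !inE => /andP[-> /ltW].
Qed.

Lemma multiplicityE b d : b < d ->
  (multiplicity F K f p b d)%:Z =
    ((N (sublevel K f b) (sublevel K f d))%:Z
       - (N (sublevel K f b) (sublevel_lt K f d))%:Z)
  - ((N (sublevel_lt K f b) (sublevel K f d))%:Z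
       - (N (sublevel_lt K f b) (sublevel_lt K f d))%:Z).
Proof.
move=> bd; rewrite /multiplicity bd /homology_rank.
have NZ A B : (N A B <= \dim (cycles F A p))%N by apply/dimvS/capvSl.
have Bd : (boundaries F (sublevel_lt K f d) p <= boundaries F (sublevel K f d) p)%VS.
  exact/limgS/chainsS/sublevel_ltS.
have NS A : (N A (sublevel_lt K f d) <= N A (sublevel K f d))%N.
  exact/dimvS/capvS.
have := dim_cap_submodular (cyclesS p (sublevel_ltS b)) Bd.
rewrite -/(N _ _) -/(N _ _) -/(N _ _) -/(N _ _).
move: (NZ (sublevel K f b) (sublevel K f d)) (NZ (sublevel K f b) (sublevel_lt K f d)).
move: (NZ (sublevel_lt K f b) (sublevel K f d)) (NZ (sublevel_lt K f b) (sublevel_lt K f d)).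
move: (NS (sublevel K f b)) (NS (sublevel_lt K f b)).
lia.
Qed.

Lemma multiplicity_ooE b :
  (multiplicity_oo F K f p b)%:Z =
    ((\dim (cycles F (sublevel K f b) p))%:Z - (N (sublevel K f b) K)%:Z)
  - ((\dim (cycles F (sublevel_lt K f b) p))%:Z - (N (sublevel_lt K f b) K)%:Z).
Proof.
rewrite /multiplicity_oo /homology_rank.
have NZ A B : (N A B <= \dim (cycles F A p))%N by apply/dimvS/capvSl.
have := dim_cap_submodular (cyclesS p (sublevel_ltS b)) (subvf (boundaries F K p)).
rewrite !capvf -/(N _ _) -/(N _ _).
move: (NZ (sublevel K f b) K) (NZ (sublevel_lt K f b) K).
lia.
Qed.

Definition alive (u : R) (x : R * \bar R) : bool := (x.1 <= u) && (u%:E < x.2)%E.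

Lemma cycles0 q : cycles F (finset.set0 : {set {set T}}) q = 0%VS.
Proof.
apply/eqP; rewrite -dimv_eq0 -leqn0.
apply: (leq_trans (dimvS (capvSl _ _))); rewrite dim_chains leqn0 cards_eq0.
by apply/eqP/setP => s; rewrite !inE.
Qed.

Lemma sumn_intE (I : eqType) (r : seq I) (G : I -> nat) :
  (sumn [seq G i | i <- r])%:Z = \sum_(i <- r) (G i)%:Z.
Proof. by rewrite sumnE big_map; elim/big_rec2: _ => // i x y _ <-; rewrite PoszD. Qed.

(** Write [Ku] for the sublevel complex at [u]. Telescoping over births and deaths, the finite
    intervals contribute [N Ku K - N Ku Ku] and the infinite ones [\dim (cycles F Ku p) - N Ku K];
    the sum is the Betti number of [Ku] when boundaries are cycles. *)
Lemma count_alive u :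
  (count (alive u) (persistence_diagram F K f p))%:Z =
    (\dim (cycles F (sublevel K f u) p))%:Z
    - (\dim (cycles F (sublevel K f u) p :&: boundaries F (sublevel K f u) p)%VS)%:Z.
Proof.
have le_down v w : w <= v -> v <= u -> w <= u by exact: le_trans.
have up_all (v w : R) : w <= v -> predT v -> predT w by [].
have subT : [set s in K | predT (f s)]%SET = K by apply/setP => s; rewrite !inE andbT.
have N0 B : N finset.set0 B = 0%N.
  by apply/eqP; rewrite /N cycles0 cap0v dimv0.
rewrite /persistence_diagram count_cat PoszD !count_flatten.
set cv := critical_values K f.
have -> : (sumn [seq count (alive u) i | i <-
    flatten [seq [seq nseq (multiplicity F K f p b d) (b, d%:E) | d <- cv] | b <- cv]])%:Z
  = \sum_(b <- cv | b <= u) \sum_(d <- cv | u < d) (multiplicity F K f p b d)%:Z.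
  rewrite sumn_intE big_flatten /= big_map [RHS]big_mkcond /=; apply: eq_bigr => b _.
  rewrite big_map; case: ifP => bu; last first.
    by rewrite big1 // => d _; rewrite count_nseq /alive /= bu.
  rewrite [RHS]big_mkcond; apply: eq_bigr => d _.
  by rewrite count_nseq /alive /= bu lte_fin; case: ifP; rewrite ?mul1n.
have -> : (sumn [seq count (alive u) i | i <-
    [seq nseq (multiplicity_oo F K f p b) (b, +oo%E) | b <- cv]])%:Z
  = \sum_(b <- cv | b <= u) (multiplicity_oo F K f p b)%:Z.
  rewrite sumn_intE big_map [RHS]big_mkcond /=; apply: eq_bigr => b _.
  by rewrite count_nseq /alive /= ltry andbT; case: ifP; rewrite ?mul1n.
pose g A := (N A K)%:Z - (N A (sublevel K f u))%:Z.
(* The deaths above [u] are all critical values except those at most [u], and both of these sums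
   telescope. *)
have inner A : \sum_(d <- cv | u < d)
    ((N A (sublevel K f d))%:Z - (N A (sublevel_lt K f d))%:Z) = g A.
  have h1 := sum_critical_values (fun B => (N A B)%:Z) up_all.
  have := sum_critical_values (fun B => (N A B)%:Z) le_down.
  move: h1; rewrite (bigID (fun v => v <= u)) /= -/cv subT -/(sublevel K f u).
  under [X in _ + X = _]eq_bigl do rewrite -ltNge.
  by move=> h1 h2; move: h1; rewrite h2 /g => /(canRL (addKr _)) ->; ring.
have -> : \sum_(b <- cv | b <= u) \sum_(d <- cv | u < d) (multiplicity F K f p b d)%:Z
   = \sum_(b <- cv | b <= u) (g (sublevel K f b) - g (sublevel_lt K f b)).
  apply: eq_bigr => b bu; rewrite -!inner -sumrB; apply: eq_bigr => d ud.
  by rewrite multiplicityE //; exact: le_lt_trans ud.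
rewrite sum_critical_values // -/(sublevel K f u).
under eq_bigr do rewrite multiplicity_ooE.
rewrite (sum_critical_values (fun A => (\dim (cycles F A p))%:Z - (N A K)%:Z)) //.
rewrite -/(sublevel K f u) /g !N0 cycles0 dimv0 /N; lia.
Qed.

Lemma persistence_diagram_mem x : x \in persistence_diagram F K f p ->
  x.1 \in critical_values K f /\
  (x.2 = +oo%E \/ exists2 d, d \in critical_values K f & x.2 = d%:E).
Proof.
rewrite mem_cat => /orP[] /flattenP[e].
  case/allpairsP => -[b d] /= [bK dK ->] /nseqP[-> _] /=.
  by split=> //; right; exists d.
by case/mapP => b bK -> /nseqP[-> _]; split => //; left.
Qed.

End DiagramCount.

(** * Stability of the number of live intervals under a cheap matching *)

Section BottleneckCount.
Variable R : realType.
Implicit Types (D : seq (R * \bar R)) (x y : R * \bar R).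

Definition avoids (u e r : R) : bool := (r <= u) || (u + 2 * e < r).

Definition avoids_point (u e : R) x : Prop :=
  avoids u e x.1 /\ (x.2 = +oo%E \/ exists2 d, avoids u e d & x.2 = d%:E).

Lemma point_dist_sym x y : point_dist x y = point_dist y x.
Proof.
rewrite /point_dist /death_dist distrC eq_sym; congr maxe.
by case: eqP => // _; case: x y => [? [?||]] [? [?||]] //=; rewrite distrC.
Qed.

(** A birth at most [u] moves by less than [e], so it stays below [u + 2 * e] and hence, by
    avoidance, at most [u]. A death above [u] exceeds [u + 2 * e], so it stays above [u]. *)
Lemma alive_close u e x y : (point_dist x y < e%:E)%E ->
  avoids_point u e x -> avoids_point u e y -> alive u x -> alive u y.
Proof.
move=> + [gx1 gx2] [gy1 gy2] /andP[xu ux].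
rewrite /point_dist gt_max lte_fin => /andP[xy1 xy2]; apply/andP.
have e0 : 0 < e by exact: le_lt_trans xy1.
move: xy1; rewrite ltr_distl => /andP[xy1 xy1'].
split.
  by case/orP: gy1 => // ?; lra.
case: gy2 => [->|[d' gd' yE]]; first exact: ltry.
move: xy2; rewrite yE /death_dist lte_fin; case: gx2 => [->|[d gd xE]] //=.
move: ux; rewrite xE lte_fin => ud.
case: eqP => [[<-] //|_]; rewrite lte_fin ltr_distl => /andP[? ?].
case/orP: gd => ?; lra.
Qed.

(** A live interval has to bridge the whole gap of length [2 * e], and the distance to the diagonal
    is half the length. *)
Lemma diagonal_dist_alive u e x : avoids_point u e x -> alive u x ->
  (e%:E <= diagonal_dist x)%E.
Proof.
move=> [_ gx2] /andP[xu ux]; rewrite /diagonal_dist; case: gx2 => [->|[d gd xE]].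
  by rewrite addye // gt0_mulye ?leey // lte_fin invr_gt0.
move: ux; rewrite xE lte_fin => ud; rewrite -EFinB -EFinM lee_fin.
case/orP: gd => ?; first lra.
by rewrite ler_pdivlMr //; lra.
Qed.

Lemma count_card (T : eqType) (a : pred T) (s : seq T) :
  count a s = #|[set i | a (tnth (in_tuple s) i)]%SET|.
Proof. by rewrite -sum1_count big_tnth -sum1_card; apply: eq_bigl => i; rewrite inE. Qed.

(** A matching of cost below [e] can send no live point to the diagonal, on either side, and it
    pairs live points with live points; it therefore restricts to a bijection between them. *)
Lemma bottleneck_count D D' (u e : R) : (bottleneck D D' < e%:E)%E ->
  (forall x, x \in D ++ D' -> avoids_point u e x) ->
  count (alive u) D = count (alive u) D'.
Proof.
move=> /ereal_inf_lt[_ [M Minj <-]]; rewrite gt_max => /andP[].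
move=> /bigmax_ltP[_ MD] /bigmax_ltP[_ MD'] g.
have gD i : avoids_point u e (tnth (in_tuple D) i).
  by apply: g; rewrite mem_cat mem_tnth.
have gD' j : avoids_point u e (tnth (in_tuple D') j).
  by apply: g; rewrite mem_cat mem_tnth orbT.
rewrite !count_card.
set A := [set i | _]%SET; set B := [set j | _]%SET.
have MA i : i \in A -> exists2 j, M i = Some j & j \in B.
  rewrite inE => iA; have := MD i isT.
  case: (M i) => [j|] ij; last first.
    by move: (lt_le_trans ij (diagonal_dist_alive (gD i) iA)); rewrite ltxx.
  by exists j => //; rewrite inE; exact: alive_close ij (gD i) (gD' j) iA.
have Minj' : {in A &, injective M}.
  move=> i i' /MA[j Mi _] _ Mi'; apply: (Minj _ _ j) => //; by rewrite -Mi' Mi.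
rewrite -(card_in_imset Minj') -(card_imset B (@Some_inj _)).
congr #|pred_of_set _|; apply/setP => o; apply/imsetP/imsetP => -[].
  by move=> i /MA[j -> jB] ->; exists j.
move=> j; rewrite inE => jB ->.
have /existsP[i /eqP Mi] : [exists i, M i == Some j].
  apply: contraTT jB; rewrite negb_exists => /MD' jd; apply/negP => ja.
  by move: (lt_le_trans jd (diagonal_dist_alive (gD' j) ja)); rewrite ltxx.
exists i => //; rewrite inE; have := MD i isT; rewrite Mi point_dist_sym => ij.
exact: alive_close ij (gD' j) (gD i) jB.
Qed.

End BottleneckCount.

(** * Euler characteristics as signed sums over simplices *)

Section EulerSums.
Local Open Scope fset_scope.

(* For [h] the indicator of a sublevel set, the Euler characteristic of the
   corresponding sublevel complex. *)
Definition skeleton_sum (W : choiceType) (m : nat) (S : {fset W})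
    (h : {fset W} -> int) : int :=
  \sum_(s <- fpowerset S | (0 < #|` s| <= m.+1)%N) (-1) ^+ #|` s|.-1 * h s.

Lemma sum_by_card (T : finType) (K : {set {set T}}) m (w : nat -> int) :
  (forall s, s \in K -> (0 < #|s| <= m.+1)%N) ->
  \sum_(p < m.+1) w p * (#|[set s in K | #|s| == p.+1]%SET|)%:Z
  = \sum_(s in K) w #|s|.-1.
Proof.
move=> Km; rewrite (partition_big (fun s : {set T} => inord #|s|.-1 : 'I_m.+1) predT) //=.
apply: eq_bigr => p _; rewrite -sum1_card -natz natr_sum mulr_sumr /=.
have sE s : s \in K -> (#|s| == p.+1) = (inord #|s|.-1 == p).
  by move=> /Km /andP[s0 sm]; rewrite -val_eqE /= inordK; move: s0 sm; case: #|s|.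
apply: eq_big => [s|s]; first by rewrite !inE; case sK: (s \in K) => //=; exact: sE.
by rewrite !inE => /andP[_ /eqP ->]; rewrite mulr1.
Qed.

Lemma card_fsetval (W : choiceType) (S : {fset W}) (t : {set S}) :
  #|` [fset val x | x in t]| = #|t|.
Proof. by rewrite card_imfset /= ?cardE //; exact: val_inj. Qed.

Lemma sum_fpowerset (W : choiceType) (S : {fset W}) (P : pred {fset W})
    (G : {fset W} -> int) :
  \sum_(s <- fpowerset S | P s) G s =
  \sum_(t : {set S} | P [fset val x | x in t]) G [fset val x | x in t].
Proof.
rewrite big_mkcond [RHS]big_mkcond /fpowerset big_imfset /=; last first.
  by move=> s t _ _ /(congr1 (fsub S)); rewrite !FSetK.
rewrite big_enum /=; apply: eq_bigl => t.
by rewrite finset.powersetE finset.subsetT.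
Qed.

Lemma skeleton_sumE (W : choiceType) m (S : {fset W}) (h : {fset W} -> bool) :
  skeleton_sum m S (fun s => (h s)%:R) =
  \sum_(p < m.+1) (-1) ^+ p *
    (#|[set t in [set t in skeleton S m | h [fset val x | x in t]]
         | #|t| == p.+1]%SET|)%:Z.
Proof.
rewrite (sum_by_card (fun p => (-1) ^+ p)); last by move=> s; rewrite !inE => /andP[].
rewrite /skeleton_sum sum_fpowerset; under eq_bigl do rewrite card_fsetval.
under [LHS]eq_bigr do rewrite card_fsetval.
rewrite [LHS]big_mkcond [RHS]big_mkcond /=; apply: eq_bigr => t _.
by rewrite !inE; case: ifP => //= _; case: (h _); rewrite ?mulr1 ?mulr0.
Qed.

Lemma alternating_sum_bin n m :
  \sum_(p < m) (-1) ^+ p * ('C(n.+1, p.+1))%:Z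
  = 1 - (-1) ^+ m * ('C(n, m))%:Z :> int.
Proof.
elim: m => [|m IH]; first by rewrite big_ord0 bin0; ring.
by rewrite big_ord_recr /= IH binS PoszD exprS; ring.
Qed.

(** The [m]-skeleton of a simplex with [n] vertices is a wedge of ['C(n.-1, m.+1)] spheres of
    dimension [m]. The face count itself is summed by Pascal's rule. *)
Lemma skeleton_sum1 (W : choiceType) m (S : {fset W}) : S != fset0 ->
  skeleton_sum m S (fun=> 1) = (1 + (-1) ^+ m * ('C(#|` S|.-1, m.+1))%:Z)%R.
Proof.
rewrite -cardfs_gt0 => S0; rewrite (skeleton_sumE m S (fun=> true)).
transitivity (\sum_(p < m.+1) (-1) ^+ p * ('C(#|` S|.-1.+1, p.+1))%:Z : int).
  apply: eq_bigr => p _; congr (_ * Posz _).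
  rewrite prednK // cardfE -[in RHS]card_draws; congr #|pred_of_set _|.
  apply/setP => t; rewrite !inE andbT; case: eqP => [->|]; last by rewrite andbF.
  by rewrite andbT ltnS /= ltn_ord.
by rewrite alternating_sum_bin exprS; ring.
Qed.

Lemma skeleton_sum_imfset (W V : choiceType) (phi : W -> V) m (S : {fset W})
    (h : {fset V} -> int) : {in S &, injective phi} ->
  skeleton_sum m [fset phi x | x in S] h =
  skeleton_sum m S (fun s => h [fset phi x | x in s]).
Proof.
move=> inj.
have card_phi s : s `<=` S -> #|` [fset phi x | x in s]| = #|` s|.
  move=> /fsubsetP sS; rewrite card_in_imfset //= => x y /sS xS /sS yS.
  exact: inj.
have -> : skeleton_sum m [fset phi x | x in S] h =
  \sum_(t <- [fset [fset phi x | x in (s : {fset W})] | s in fpowerset S]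
     | (0 < #|` t| <= m.+1)%N) (-1) ^+ #|` t|.-1 * h t.
  apply: eq_fbigl_cond => t; rewrite !inE; congr (_ && _).
  rewrite fpowersetE; apply/idP/imfsetP => [tS|[s /=]]; last first.
    rewrite fpowersetE => /fsubsetP sS ->; apply/fsubsetP => _ /imfsetP[x /= xs ->].
    by apply/imfsetP; exists x => //=; exact: sS.
  exists [fset x in S | phi x \in t] => /=.
    by rewrite fpowersetE; apply/fsubsetP => x; rewrite !inE /= => /andP[].
  apply/fsetP => y; apply/idP/imfsetP => [yt|[x /=]]; last by rewrite !inE /= => /andP[_ ? ->].
  have /imfsetP[x /= xS yE] := fsubsetP tS _ yt.
  by exists x => //; rewrite !inE /= xS -yE.
rewrite big_mkcond big_imfset /=; last first.
  move=> s t; rewrite !fpowersetE => /fsubsetP sS /fsubsetP tS st.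
  have sub (a b : {fset W}) : {subset a <= S} -> {subset b <= S} ->
      [fset phi x | x in a] = [fset phi x | x in b] -> {subset a <= b}.
    move=> aS bS ab x xa; have : phi x \in [fset phi x | x in b].
      by rewrite -ab; apply/imfsetP; exists x.
    by case/imfsetP => y /= yb /inj -> //; [exact: aS | exact: bS].
  apply/fsetP => x; apply/idP/idP; [exact: sub st x | exact: sub (esym st) x].
rewrite /skeleton_sum [RHS]big_mkcond /= big_seq [RHS]big_seq.
by apply: eq_bigr => s; rewrite fpowersetE => /card_phi ->.
Qed.

(* Inclusion-exclusion over the removed set [T] isolates the terms containing
   [A]; descending induction on the cardinality then isolates each term. *)
Lemma sum_superset_eq0 (W : choiceType) (S : {fset W}) m (h : {fset W} -> int) :
  (forall T, T `<=` S -> (#|` T| <= m)%N ->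
     \sum_(s <- fpowerset (S `\` T)) h s = 0) ->
  forall A T, A `<=` S -> T `<=` S -> (#|` A| + #|` T| <= m)%N ->
     \sum_(s <- fpowerset (S `\` T) | A `<=` s) h s = 0.
Proof.
move=> h0 A; move: {2}#|`A| (erefl #|`A|) => n; elim: n A => [|n IH] A.
  move=> /cardfs0_eq -> T _ TS; rewrite cardfs0 add0n => Tm.
  by rewrite -[RHS](h0 T) //; apply: eq_bigl => s; rewrite fsub0set.
move=> An T AS TS ATm.
have [a aA] : exists a, a \in A by apply/fset0Pn; rewrite -cardfs_gt0 An.
have A'n : #|` A `\ a| = n by move: An; rewrite (cardfsD1 a) aA => -[].
have A'S : A `\ a `<=` S by apply: fsubset_trans AS; exact: fsubsetDl.
have aS : a \in S by exact: (fsubsetP AS).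
have aT1 : (#|` a |` T| <= #|` T|.+1)%N by rewrite cardfsU1; case: (_ \notin _).
have aTS : a |` T `<=` S by rewrite fsubUset fsub1set aS.
have eT := IH _ A'n T A'S TS; have eaT := IH _ A'n (a |` T) A'S aTS.
have -> : \sum_(s <- fpowerset (S `\` T) | A `<=` s) h s =
    \sum_(s <- fpowerset (S `\` T) | (A `\ a `<=` s) && (a \in s)) h s.
  apply: eq_bigl => s; apply/idP/andP => [As|[As as']].
    by split; [apply: fsubset_trans As; exact: fsubsetDl | exact: (fsubsetP As)].
  by rewrite -(fsetD1K aA) fsubUset fsub1set as'.
have e2 : \sum_(s <- fpowerset (S `\` T) | (A `\ a `<=` s) && (a \notin s)) h s =
    \sum_(s <- fpowerset (S `\` (a |` T)) | A `\ a `<=` s) h s.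
  apply: eq_fbigl_cond => s; rewrite !inE /= !fpowersetE.
  rewrite !fsubsetD fdisjointXU fdisjointX1.
  by case: (s `<=` S); case: (A `\ a `<=` s); rewrite ?andbT ?andbF //= andbC.
by move: eT; rewrite (bigID (fun s : {fset W} => a \in s)) /= e2 eaT ?addr0;
  [apply; lia | lia].
Qed.

Lemma fpowerset_sum_eq0 (W : choiceType) (S : {fset W}) m (h : {fset W} -> int) :
  (forall s, (m < #|` s|)%N -> h s = 0) ->
  (forall T, T `<=` S -> (#|` T| <= m)%N ->
     \sum_(s <- fpowerset (S `\` T)) h s = 0) ->
  forall s, s `<=` S -> h s = 0.
Proof.
move=> hm h0 s; move: {2}_.+1 (ltnSn (#|` S| - #|` s|)%N) => n.
elim: n s => // n IH s sn sS; case: (ltnP m #|` s|) => [/hm //|sm].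
have := sum_superset_eq0 h0 sS (fsub0set S).
rewrite cardfs0 addn0 fsetD0 => /(_ sm); rewrite -big_filter.
rewrite (bigD1_seq s) ?mem_filter ?fpowersetE ?fsubset_refl ?filter_uniq ?fset_uniq //=.
rewrite big_filter_cond big_seq_cond big1 ?addr0 // => t.
rewrite fpowersetE => /and3P[tS st ts]; apply: IH => //.
have : s `<` t by rewrite fproperEneq eq_sym ts.
move=> /fproper_ltn_card; move: (fsubset_leq_card tS); lia.
Qed.

End EulerSums.

(** Pigeonhole: the [(size V).+1] consecutive intervals of length [2 * e] starting at [a] are
    disjoint and half-open, so one of them contains no element of [V]; its left end still lies below
    [b]. *)
Lemma gap_exists (R : realType) (V : seq R) (a b e : R) : 0 < e ->
  (size V)%:R * (2 * e) < b - a ->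
  exists u, [/\ a <= u, u < b & forall r, r \in V -> avoids u e r].
Proof.
move=> e0 Vab; pose v (i : nat) := a + i%:R * (2 * e).
have vS i : v i.+1 = v i + 2 * e by rewrite /v -natr1; ring.
have vmono i j : (i <= j)%N -> v i <= v j.
  by move=> ij; rewrite lerD2l ler_wpM2r ?ler_nat //; lra.
case: (pselect (exists2 i, (i <= size V)%N & all (avoids (v i) e) V)).
  case=> i iV /allP Vi; exists (v i); split => //.
    by rewrite lerDl mulr_ge0 //; lra.
  by apply: le_lt_trans (vmono _ _ iV) _; rewrite /v; lra.
move=> nV.
have bad (i : 'I_(size V).+1) : exists r, (r \in V) && (v i < r <= v i.+1).
  have /allPn[r rV] : ~~ all (avoids (v i) e) V.
    by apply/negP => iV; apply: nV; exists (i : nat); rewrite // -ltnS.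
  by rewrite negb_or -ltNge -leNgt -vS => ?; exists r; rewrite rV.
pose w i := xchoose (bad i).
have wP i : (w i \in V) && (v i < w i <= v i.+1) := xchooseP (bad i).
have w_lt (i j : 'I_(size V).+1) : (i < j)%N -> w i < w j.
  move=> ij; have /and3P[_ _ wi] := wP i; have /and3P[_ wj _] := wP j.
  by apply: le_lt_trans wi (le_lt_trans _ wj); exact: vmono.
have winj : injective w.
  move=> i j wij; apply: val_inj; case: (ltngtP i j) => // /w_lt;
  by rewrite wij ltxx.
have : (size [seq w i | i : 'I_(size V).+1] <= size V)%N.
  apply: uniq_leq_size; first by rewrite map_inj_uniq // enum_uniq.
  by move=> _ /mapP[i _ ->]; have /andP[] := wP i.
by rewrite size_map size_enum_ord ltnn.
Qed.

(** * From persistence diagrams to Euler characteristics of sublevel complexes *)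

Section LevelSets.
Variable R : realType.
Local Open Scope fset_scope.

Definition monotone_filtration (W : choiceType) (f : {fset W} -> R) :=
  forall s t : {fset W}, s != fset0 -> s `<=` t -> f s <= f t.

Definition simplex_values (W : choiceType) (m : nat) (f : {fset W} -> R)
    (S : {fset W}) : seq R :=
  [seq f s | s <- fpowerset S & (0 < #|` s| <= m.+1)%N].

Lemma simplex_values_mem (W : choiceType) m (f : {fset W} -> R) (S s : {fset W}) :
  s `<=` S -> (0 < #|` s| <= m.+1)%N -> f s \in simplex_values m f S.
Proof. by move=> sS sm; apply: map_f; rewrite mem_filter sm fpowersetE. Qed.

Lemma simplex_valuesS (W : choiceType) m (f : {fset W} -> R) (S S' : {fset W}) :
  S' `<=` S -> {subset simplex_values m f S' <= simplex_values m f S}.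
Proof.
move=> SS' _ /mapP[s + ->]; rewrite mem_filter fpowersetE => /andP[sm sS].
exact: simplex_values_mem (fsubset_trans sS SS') sm.
Qed.

Lemma size_simplex_values (W : choiceType) m (f : {fset W} -> R) (S : {fset W}) :
  size (simplex_values m f S) = (\sum_(1 <= i < m.+2) 'C(#|` S|, i))%N.
Proof.
apply/eqP; rewrite -eqz_nat; apply/eqP; rewrite size_map size_filter -sum1_count.
rewrite -[LHS]natz natr_sum sum_fpowerset /=; under eq_bigl do rewrite card_fsetval.
transitivity (\sum_(t in skeleton S m) (1 : int)).
  by apply: eq_bigl => t; rewrite inE.
rewrite -(@sum_by_card S _ m (fun=> 1)); last by move=> s; rewrite inE.
rewrite -[RHS]natz natr_sum big_add1 big_mkord; apply: eq_bigr => p _.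
rewrite mul1r natz cardfE -[in RHS]card_draws; congr (Posz #|pred_of_set _|).
apply/setP => t; rewrite !inE; case: eqP => [->|]; last by rewrite andbF.
by rewrite andbT /= ltn_ord.
Qed.

Section OneSpace.
Variables (W : metricType R) (F : fieldType) (m : nat) (f : {fset W} -> R).

(** The live intervals in degree [p] number the [p]-th Betti number of the sublevel complex, which
    monotonicity makes closed under faces, so Euler-Poincare applies. *)
Lemma euler_persistence (S : {fset W}) (u : R) : monotone_filtration f ->
  \sum_(p < m.+1) (-1) ^+ p * (count (alive u) (persistence F m f S p))%:Z =
  skeleton_sum m S (fun s => (f s <= u)%R%:R) :> int.
Proof.
move=> fmono; rewrite (skeleton_sumE m S (fun s => f s <= u)).
set K := [set t in skeleton S m | _]%SET.
have KE : sublevel (skeleton S m) (fun s : {set S} => f [fset val x | x in s]) u = K.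
  by [].
have Kcl : face_closed K.
  move=> s t; rewrite !inE => /andP[/andP[_ sm] su] ts t0.
  rewrite card_gt0 t0 (leq_trans (subset_leq_card ts) sm) /=.
  apply: le_trans su; apply: fmono.
    by rewrite -cardfs_gt0 card_fsetval card_gt0.
  by apply: subset_imfset => x; exact: (fintype.subsetP ts).
have Km s : s \in K -> (#|s| <= m.+1)%N by rewrite !inE => /andP[/andP[]].
rewrite -(euler_poincare F Kcl Km); apply: eq_bigr => p _; congr (_ * _).
rewrite /persistence count_alive KE.
by rewrite (capv_idPr (boundaries_sub_cycles F p Kcl)).
Qed.

Lemma persistence_avoids (S : {fset W}) p u e :
  (forall r, r \in simplex_values m f S -> avoids u e r) ->
  forall x, x \in persistence F m f S p -> avoids_point u e x.
Proof.
move=> av; have av' r : r \in critical_values (skeleton S m)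
    (fun s : {set S} => f [fset val x | x in s]) -> avoids u e r.
  rewrite mem_undup => /mapP[s]; rewrite mem_enum inE => sm ->; apply: av.
  apply: simplex_values_mem; last by rewrite card_fsetval.
  by apply/fsubsetP => _ /imfsetP[x _ ->]; exact: fsvalP.
move=> x /persistence_diagram_mem[/av' x1 x2]; split => //.
by case: x2 => [|[d /av' ? ?]]; [left | right; exists d].
Qed.

End OneSpace.

Lemma skeleton_sum_eq (W V : metricType R) (F : fieldType) m
    (f : {fset W} -> R) (g : {fset V} -> R) (S : {fset W}) (S' : {fset V}) u e :
  monotone_filtration f -> monotone_filtration g ->
  (graded_bottleneck (persistence F m f S) (persistence F m g S') < e%:E)%E ->
  (forall r, r \in simplex_values m f S ++ simplex_values m g S' -> avoids u e r) ->
  skeleton_sum m S (fun s => (f s <= u)%R%:R) =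
  skeleton_sum m S' (fun s => (g s <= u)%R%:R).
Proof.
move=> fmono gmono gb av.
rewrite -(euler_persistence F) // -(euler_persistence F) //.
apply: eq_bigr => p _; congr (_ * Posz _); apply: (@bottleneck_count _ _ _ u e).
  by apply: le_lt_trans gb; apply: ereal_sup_ubound; exists (p : nat).
move=> x; rewrite mem_cat => /orP[] /persistence_avoids; apply => r rv;
  by apply: av; rewrite mem_cat rv ?orbT.
Qed.

End LevelSets.

(** * Comparing the filtration on a finite set with that on its image *)

Section Comparison.
Variables (R : realType) (F : fieldType) (m : nat).
Variables (Z Y : metricType R) (phi : Z -> Y).
Variables (f : {fset Z} -> R) (g : {fset Y} -> R).
Hypotheses (m_gt0 : (0 < m)%N) (f_mono : monotone_filtration f)
  (g_mono : monotone_filtration g).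
Hypotheses (f_edge : forall x y, f [fset x; y]%fset = mdist x y)
  (g_edge : forall x y, g [fset x; y]%fset = mdist x y).

Let img (S : {fset Z}) : {fset Y} := [fset phi x | x in S]%fset.
Let close (e : R) (S : {fset Z}) : Prop :=
  (graded_bottleneck (persistence F m f S) (persistence F m g (img S)) < e%:E)%E.
Let values (S : {fset Z}) : seq R := simplex_values m f S ++ simplex_values m g (img S).

Let imgS S S' : (S' `<=` S)%fset -> (img S' `<=` img S)%fset.
Proof. by move=> /fsubsetP SS'; apply: subset_imfset. Qed.

Let valuesS S S' : (S' `<=` S)%fset -> {subset values S' <= values S}.
Proof.
move=> SS' r; rewrite !mem_cat => /orP[] /simplex_valuesS ->//; rewrite ?orbT //.
exact: imgS.
Qed.

Let f_vertex x : f [fset x]%fset = 0.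
Proof. by rewrite -(fsetUid [fset x]%fset) f_edge mdistxx. Qed.

Let g_vertex y : g [fset y]%fset = 0.
Proof. by rewrite -(fsetUid [fset y]%fset) g_edge mdistxx. Qed.

Lemma sublevel_agree (S : {fset Z}) u e : {in S &, injective phi} ->
  (forall T, (T `<=` S)%fset -> (#|` T| <= m.+1)%N -> close e (S `\` T)%fset) ->
  (forall r, r \in values S -> avoids u e r) ->
  forall s, (s `<=` S)%fset -> (0 < #|` s| <= m.+1)%N -> (f s <= u) = (g (img s) <= u).
Proof.
move=> inj cl av s sS sm.
(* The signed difference of the two indicators, cut off outside the [m]-skeleton. Its sum over
   subsets of [S \ T] is a difference of Euler characteristics, and the same [u] is admissible for
   every [T] because [values] only shrinks. *)
pose h (t : {fset Z}) : int := if (0 < #|` t| <= m.+1)%N then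
  (-1) ^+ #|` t|.-1 * ((f t <= u)%R%:R - (g (img t) <= u)%R%:R) else 0.
have : h s = 0.
  apply: (fpowerset_sum_eq0 (m := m.+1) _ _ sS) => [t tm|T TS Tm].
    by rewrite /h (leqNgt _ m.+1) tm andbF.
  have DS : (S `\` T `<=` S)%fset by exact: fsubsetDl.
  have injD : {in (S `\` T)%fset &, injective phi}.
    by move=> x y /(fsubsetP DS) xS /(fsubsetP DS) yS; exact: inj.
  have := skeleton_sum_eq f_mono g_mono (cl T TS Tm) (fun r rv => av r (valuesS DS rv)).
  rewrite skeleton_sum_imfset // => /eqP; rewrite -subr_eq0 => /eqP E; rewrite -[RHS]E.
  rewrite /skeleton_sum -sumrB [RHS]big_mkcond /=; apply: eq_bigr => t _.
  by rewrite /h; case: ifP => // _; rewrite mulrBr.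
rewrite /h sm => /eqP; rewrite mulf_eq0 signr_eq0 /=.
by do 2 case: (_ <= u).
Qed.

Lemma dist_close_inj (S : {fset Z}) e x y (V : seq R) : 0 < e ->
  {in S &, injective phi} ->
  (forall T, (T `<=` S)%fset -> (#|` T| <= m.+1)%N -> close e (S `\` T)%fset) ->
  {subset values S <= V} -> x \in S -> y \in S -> x != y ->
  `|mdist x y - mdist (phi x) (phi y)| <= (size V)%:R * (2 * e).
Proof.
move=> e0 inj cl SV xS yS xy; rewrite leNgt; apply/negP => lt_d.
(* As [m > 0] and [x != y], the edge is a simplex of the skeleton, so [sublevel_agree] applies to
   it. *)
have agree u : (forall r, r \in V -> avoids u e r) ->
    (mdist x y <= u) = (mdist (phi x) (phi y) <= u).
  move=> av; rewrite -f_edge -g_edge -imfset_fset2.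
  apply: (sublevel_agree inj cl) => [r /SV/av //||].
    by rewrite fsubUset !fsub1set xS.
  by rewrite cardfs2 xy /= ltnS.
move: lt_d; case: (lerP (mdist (phi x) (phi y)) (mdist x y)) => [le_d|/ltW le_d] lt_d.
  have [u [du ud /agree]] : exists u, [/\ mdist (phi x) (phi y) <= u, u < mdist x y &
      forall r, r \in V -> avoids u e r].
    by apply: gap_exists => //; rewrite ger0_norm ?subr_ge0 in lt_d.
  by rewrite du leNgt ud.
have [u [du ud /agree]] : exists u, [/\ mdist x y <= u, u < mdist (phi x) (phi y) &
    forall r, r \in V -> avoids u e r].
  by apply: gap_exists => //; rewrite distrC ger0_norm ?subr_ge0 in lt_d.
by rewrite du [RHS]leNgt ud.
Qed.

(* Above all filtration values, equality of Euler characteristics forces equal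
   numbers of vertices, provided that the [m]-skeleton is not contractible. *)
Lemma inj_of_close (S : {fset Z}) e : close e S -> (m.+1 < #|` S|)%N ->
  {in S &, injective phi}.
Proof.
move=> cl mS.
pose u := \big[Num.max/0]_(r <- values S) r.
have uV r : r \in values S -> r <= u by move=> rV; exact: le_bigmax_seq.
have av r : r \in values S -> avoids u e r by move=> /uV ru; rewrite /avoids ru.
have := skeleton_sum_eq f_mono g_mono cl av.
have fu : skeleton_sum m S (fun s => (f s <= u)%R%:R) = skeleton_sum m S (fun=> 1).
  rewrite /skeleton_sum big_seq_cond [RHS]big_seq_cond; apply: eq_bigr => s.
  rewrite fpowersetE => /andP[sS sm]; rewrite uV //.
  by rewrite mem_cat simplex_values_mem.
have gu : skeleton_sum m (img S) (fun s => (g s <= u)%R%:R) = skeleton_sum m (img S) (fun=> 1).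
  rewrite /skeleton_sum big_seq_cond [RHS]big_seq_cond; apply: eq_bigr => s.
  rewrite fpowersetE => /andP[sS sm]; rewrite uV //.
  by rewrite mem_cat simplex_values_mem ?orbT.
have S0 : S != fset0 by rewrite -cardfs_gt0; exact: leq_ltn_trans mS.
have imS0 : img S != fset0.
  by have /fset0Pn[x xS] := S0; apply/fset0Pn; exists (phi x); apply/imfsetP; exists x.
rewrite fu gu !skeleton_sum1 // => /addrI/(can_inj (signrMK _))[] binE.
apply/card_in_imfsetP; rewrite eqn_leq leq_imfset_card /=.
rewrite leqNgt; apply/negP => lt_card.
have : (0 < #|` img S|)%N by rewrite cardfs_gt0.
(* With [b.+1] points and [a.+1] images, [a < b], Pascal's rule and monotonicity squeeze ['C(a, m)]
   to 0. Then ['C(a, m.+1)] is 0 as well, whereas ['C(b, m.+1)] is positive. *)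
move: binE lt_card mS; rewrite -/(img S).
case: #|` S| => // b; case: #|` img S| => // a /= binE; rewrite !ltnS => ab mb _.
have := leq_bin2l m.+1 ab; rewrite binE binS -[X in (_ <= X)%N]addn0 leq_add2l leqn0.
rewrite eqn0Ngt bin_gt0 -ltnNge => am.
by move: mb; rewrite -bin_gt0 binE bin_small // ltnW.
Qed.

(* The comparison of the total Euler characteristic with the one of the point
   [phi x] shows that the edge has already appeared. *)
Lemma dist_close_collapse e x y (V : seq R) : 0 < e -> phi x = phi y ->
  close e [fset x; y]%fset -> {subset values [fset x; y]%fset <= V} ->
  mdist x y <= (size V)%:R * (2 * e).
Proof.
move=> e0 phixy cl SV; have [->|xy] := eqVneq x y.
  by rewrite mdistxx mulr_ge0 //; lra.
rewrite leNgt; apply/negP => lt_d.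
have [u [u0 ud av]] : exists u, [/\ 0 <= u, u < mdist x y &
    forall r, r \in V -> avoids u e r].
  by apply: gap_exists; rewrite // subr0.
have := skeleton_sum_eq f_mono g_mono cl (fun r rv => av r (SV r rv)).
have -> : img [fset x; y]%fset = [fset phi x]%fset.
  by rewrite /img imfset_fset2 -phixy fsetUid.
(* A point and a full edge both have Euler characteristic 1; for the edge, the binomial correction
   vanishes because [m > 0]. *)
have -> : skeleton_sum m [fset phi x]%fset (fun s => (g s <= u)%R%:R) =
    skeleton_sum m [fset x; y]%fset (fun=> 1).
  transitivity (skeleton_sum m [fset phi x]%fset (fun=> 1)).
    rewrite /skeleton_sum big_seq_cond [RHS]big_seq_cond; apply: eq_bigr => s.
    rewrite fpowersetE fsubset1 => /andP[/orP[/eqP ->|/eqP ->]].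
      by rewrite g_vertex u0.
    by rewrite cardfs0.
  rewrite !skeleton_sum1 -?cardfs_gt0 ?cardfs1 ?cardfs2 //.
  by rewrite xy /= bin_small // bin_small.
(* Vertices are present at every level [u >= 0], so only the term of the edge survives; it is
   nonzero since the edge is absent at [u]. *)
move=> /esym/eqP; rewrite -subr_eq0 /skeleton_sum -sumrB.
rewrite -big_filter (bigD1_seq [fset x; y]%fset) ?filter_uniq ?fset_uniq //=; last first.
  by rewrite mem_filter fpowersetE fsubset_refl cardfs2 xy /= ltnS m_gt0.
rewrite big_filter_cond big_seq_cond big1 ?addr0.
  by rewrite f_edge leNgt ud mulr0 subr0 mulr1 signr_eq0.
move=> s; rewrite fpowersetE => /and3P[sS /andP[s0 sm] sxy].
have : (s `<` [fset x; y])%fset by rewrite fproperEneq sxy.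
move=> /fproper_ltn_card; rewrite cardfs2 xy ltnS => s1.
have /cardfs1P[z ->] : #|` s| == 1%N by rewrite eqn_leq s1.
by rewrite f_vertex u0 subrr.
Qed.

End Comparison.

(** * Distance distortion in terms of the number of filtration values *)

Lemma graded_bottleneck_ge0 (R : realType) (D D' : nat -> seq (R * \bar R)) :
  (0 <= graded_bottleneck D D')%E.
Proof.
apply: (@le_trans _ _ (bottleneck (D 0%N) (D' 0%N))).
  by apply/ereal_infP => _ [M _ <-]; rewrite le_max bigmax_ge_id.
by apply: ereal_sup_ubound; exists 0%N.
Qed.

(** [N] bounds the number of values to be avoided, each costing a gap of length [2 * eps]; the two
    filtrations enter only through monotonicity, their edge values and this count. *)
Lemma quasi_isometry_of_persistence (R : realType) (F : fieldType) (k m : nat)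
    (Z Y : metricType R) (phi : Z -> Y) (f : {fset Z} -> R) (g : {fset Y} -> R)
    (X : set Z) (Gamma : set {fset Z}) (eps : R) (N : nat) :
  (0 < m)%N -> (m < k)%N ->
  monotone_filtration f -> monotone_filtration g ->
  (forall x y, f [fset x; y]%fset = mdist x y) ->
  (forall x y, g [fset x; y]%fset = mdist x y) ->
  covering_property k X Gamma -> closure_property k m Gamma ->
  (forall S : {fset Z}, Gamma S ->
    (graded_bottleneck (persistence F m f S)
       (persistence F m g [fset phi x | x in S]%fset) <= eps%:E)%E) ->
  (forall S : {fset Z}, #|` S| = k -> exists2 V : seq R, (size V <= N)%N &
     {subset simplex_values m f S ++ simplex_values m g [fset phi x | x in S]%fset
        <= V}) ->
  quasi_isometry_on X phi (N%:R * (2 * eps)).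
Proof.
move=> m0 mk fm gm fe ge cov clo gb vals x y Xx Xy.
have [S [GS Sk xS yS]] := cov x y Xx Xy.
have eps0 : 0 <= eps.
  by rewrite -lee_fin; apply: le_trans (gb S GS); exact: graded_bottleneck_ge0.
have [V VN SV] := vals S Sk.
have [->|xy] := eqVneq x y.
  by rewrite !mdistxx subrr normr0 !mulr_ge0.
apply/ler_addgt0Pr => d d0.
(* The counting argument needs a strict bound, hence some [e > eps]; this excess adds at most [d] to
   the final estimate, and [N.+1] keeps the denominator nonzero. *)
pose e := eps + d / (2 * N.+1%:R).
have N0 : 0 < N.+1%:R :> R by rewrite ltr0n.
have lt_e : eps < e by rewrite ltrDl divr_gt0 // mulr_gt0.
have e0 : 0 < e by exact: le_lt_trans lt_e.
have cl S' : (S' `<=` S)%fset -> (k - m - 1 <= #|` S'|)%N ->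
    (graded_bottleneck (persistence F m f S')
       (persistence F m g [fset phi x | x in S']%fset) < e%:E)%E.
  move=> S'S card; apply: (@le_lt_trans _ _ eps%:E); last by rewrite lte_fin.
  by apply: gb; apply: clo GS Sk S'S card.
apply: (@le_trans _ _ ((size V)%:R * (2 * e))); last first.
  apply: (@le_trans _ _ (N%:R * (2 * e))).
    by rewrite ler_wpM2r ?ler_nat //; lra.
  rewrite /e mulrDr mulrDr lerD2l.
  have -> : N%:R * (2 * (d / (2 * N.+1%:R))) = N%:R / N.+1%:R * d :> R.
    by field; rewrite nat1r pnatr_eq0.
  by rewrite ler_piMl ?(ltW d0) // ler_pdivrMr // mul1r ler_nat.
have subsets S' T : (S' `<=` S)%fset -> (S' `\` T `<=` S)%fset.
  by apply: fsubset_trans; exact: fsubsetDl.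
have [mk1|km] := ltnP m.+1 k.
  have kS : (k - m - 1 <= #|` S|)%N by rewrite Sk -subnDA leq_subr.
  have inj := inj_of_close fm gm (cl S (fsubset_refl S) kS).
  rewrite Sk in inj; have {}inj := inj mk1.
  apply: (dist_close_inj m0 fm gm fe ge e0 inj _ SV) => // T TS Tm.
  apply: cl; first exact: subsets.
  by rewrite cardfsDS // Sk; lia.
(* Now [k = m.+1]: the skeleta of [S] and of its image are full simplices, so their total Euler
   characteristics cannot detect injectivity. The pair itself is used instead, as the closure
   property now covers all subsets of [S]. *)
have k0 : (k - m - 1 = 0)%N by lia.
have xyS : ([fset x; y] `<=` S)%fset by rewrite fsubUset !fsub1set xS.
have SV' : {subset simplex_values m f [fset x; y]%fset ++
    simplex_values m g [fset phi x | x in [fset x; y]]%fset <= V}.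
  move=> r rv; apply: SV; move: rv; rewrite !mem_cat.
  case/orP => /simplex_valuesS ->//; rewrite ?orbT //.
  by apply: subset_imfset; exact/fsubsetP.
have [phixy|phixy] := eqVneq (phi x) (phi y).
  rewrite phixy mdistxx subr0 ger0_norm ?mdist_ge0 //.
  by apply: (dist_close_collapse m0 fm gm fe ge e0 phixy _ SV'); apply: cl; rewrite ?k0.
apply: (dist_close_inj m0 fm gm fe ge e0 _ _ SV'); rewrite ?in_fset2 ?eqxx ?orbT //.
  move=> u v; rewrite !in_fset2 => /orP[] /eqP -> /orP[] /eqP -> // E;
  by rewrite E eqxx in phixy.
by move=> T _ _; apply: cl; rewrite ?k0 //; exact: subsets.
Qed.

(** * The Rips filtration *)

Section Rips.
Variables (R : realType) (W : metricType R).
Local Open Scope fset_scope.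

Lemma rips_le (s : {fset W}) r : 0 <= r ->
  (forall x y, x \in s -> y \in s -> mdist x y <= r) -> rips s <= r.
Proof.
move=> r0 sr; rewrite /rips big_seq; apply: bigmax_le => // x xs.
by rewrite big_seq; apply: bigmax_le => // y ys; exact: sr.
Qed.

Lemma mdist_le_rips (s : {fset W}) x y : x \in s -> y \in s -> mdist x y <= rips s.
Proof.
move=> xs ys; apply: (@bigmax_sup_seq _ _ _ _ _ x) => //.
exact: (@bigmax_sup_seq _ _ _ _ _ y).
Qed.

Lemma rips_ge0 (s : {fset W}) : 0 <= rips s.
Proof. exact: bigmax_ge_id. Qed.

Lemma rips_monotone : monotone_filtration (@rips R W).
Proof.
move=> s t _ /fsubsetP st; apply: rips_le; first exact: rips_ge0.
by move=> x y /st xt /st yt; exact: mdist_le_rips.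
Qed.

Lemma rips_edge (x y : W) : rips [fset x; y] = mdist x y.
Proof.
apply/eqP; rewrite eq_le mdist_le_rips ?in_fset2 ?eqxx ?orbT // andbT.
apply: rips_le => [|u v]; first exact: mdist_ge0.
by rewrite !in_fset2 => /orP[] /eqP -> /orP[] /eqP ->;
  rewrite ?mdistxx ?mdist_ge0 // metric_sym.
Qed.

(** A maximum of finitely many distances is one of them. This gives a count quadratic in the number
    of points, independent of [m]. *)
Lemma rips_values m (S : {fset W}) :
  {subset simplex_values m (@rips R W) S <= [seq mdist x y | x <- S, y <- S]}.
Proof.
move=> _ /mapP[s + ->]; rewrite mem_filter fpowersetE cardfs_gt0.
move=> /andP[/andP[/fset0Pn[x0 x0s] _] /fsubsetP sS].
pose V := [seq mdist x y | x <- S, y <- S].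
(* The default 0 of the iterated maxima is also a listed distance, from a vertex to itself. *)
have V0 : 0 \in V by rewrite -(mdistxx x0) allpairs_f // sS.
have Vmax a b : a \in V -> b \in V -> Num.max a b \in V by case: leP.
rewrite /rips big_seq; elim/big_ind: _ => // x xs.
rewrite big_seq; elim/big_ind: _ => // y ys.
by rewrite allpairs_f // sS.
Qed.

End Rips.

(** * The Cech filtration *)

Section Cech.
Variables (R : realType) (W E : metricType R) (i : W -> E).
Local Open Scope fset_scope.

Lemma cech_monotone : monotone_filtration (cech i).
Proof.
move=> s t /fset0Pn[x xs] /fsubsetP st; rewrite /cech ler_pM2l //.
(* Comparing infima requires a nonempty set and a lower bound: the center [i x] gives an element,
   and radii are nonnegative. *)
apply: lb_le_inf; first by eexists; exists (i x).
move=> _ [c _ <-]; pose M (a : {fset W}) := \big[Num.max/0]_(x <- a) mdist c (i x).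
apply: (@le_trans _ _ (M s)).
  apply: ge_inf; last by exists c.
  by exists 0 => _ [c' _ <-]; exact: bigmax_ge_id.
rewrite /M big_seq; apply: bigmax_le => [|z zs]; first exact: bigmax_ge_id.
by apply: (@bigmax_sup_seq _ _ _ _ _ z) => //; exact: st.
Qed.

End Cech.

Theorem theorem20 (R : realType) (F : fieldType) (k m : nat)
    (Z Y : metricType R) (phi : Z -> Y) (X : set Z) (Gamma : set {fset Z})
    (eps : R) :
  (0 < m)%N -> (m < k)%N ->
  phi @` X = [set: Y] ->
  (forall S : {fset Z}, Gamma S -> (k - m - 1 <= #|` S| <= k)%N) ->
  covering_property k X Gamma ->
  closure_property k m Gamma ->
  ((forall S : {fset Z}, Gamma S ->
      (graded_bottleneck (RP F m S) (RP F m [fset phi x | x in S]%fset)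
         <= eps%:E)%E) ->
   quasi_isometry_on X phi (112 * k%:R ^+ 2 * eps))
  /\
  (forall (EZ EY : metricType R) (iZ : Z -> EZ) (iY : Y -> EY),
     cech_ambient iZ -> cech_ambient iY ->
     (forall S : {fset Z}, Gamma S ->
        (graded_bottleneck (CP F m iZ S) (CP F m iY [fset phi x | x in S]%fset)
           <= eps%:E)%E) ->
     quasi_isometry_on X phi
       (224 * (\sum_(2 <= i < m.+2) 'C(k, i))%N%:R * eps)).
Proof.
move=> m_gt0 mk _ _ cov clo; split => [gb|EZ EY iZ iY [_ edgeZ] [_ edgeY] gb].
  have vals (S : {fset Z}) : #|` S| = k -> exists2 V : seq R, (size V <= 2 * k ^ 2)%N &
      {subset simplex_values m (@rips R Z) S ++
        simplex_values m (@rips R Y) [fset phi x | x in S]%fset <= V}.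
    move=> Sk; exists ([seq mdist x y | x <- S, y <- S] ++
      [seq mdist x y | x <- [fset phi x | x in S]%fset, y <- [fset phi x | x in S]%fset]).
      have : (#|` [fset phi x | x in S]%fset| <= k)%N by rewrite -Sk leq_imfset_card.
      rewrite size_cat !size_allpairs Sk mul2n -addnn mulnn => imk.
      by rewrite leq_add2l leq_mul.
    by move=> r; rewrite !mem_cat => /orP[] /rips_values ->; rewrite ?orbT.
  move=> x y Xx Xy.
  have qi := quasi_isometry_of_persistence m_gt0 mk (@rips_monotone R Z)
    (@rips_monotone R Y) (@rips_edge R Z) (@rips_edge R Y) cov clo gb vals Xx Xy.
  (* With [2 * k ^ 2] values the bound is [4 * k ^ 2 * eps]; it dominates an absolute value, so it
     is nonnegative and may be enlarged to the stated multiple. *)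
  have := le_trans (normr_ge0 _) qi; move: qi.
  rewrite natrM natrX; move=> qi B0; apply: le_trans qi _; nra.
set C := (\sum_(2 <= i < m.+2) 'C(k, i))%N.
(* Since [m > 0], the sum [C] contains ['C(k, 2)], which is at least [k / 2] for [k >= 2]. This
   absorbs the [k] vertices, missing from [C], into [2 * C]. *)
have kC : (k <= 2 * C)%N.
  rewrite /C big_ltn // mulnDr; apply: leq_trans (leq_addr _ _).
  by rewrite bin2 mul2n; case: k mk m_gt0 {cov clo C} => [|[|n]] //; nia.
have sizeC n : (n <= k)%N -> (\sum_(1 <= i < m.+2) 'C(n, i) <= 3 * C)%N.
  move=> nk; rewrite big_ltn // bin1 mulSn addnC.
  apply: leq_add; last exact: leq_trans kC.
  by apply: leq_sum => j _; exact: leq_bin2l.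
have vals (S : {fset Z}) : #|` S| = k -> exists2 V : seq R, (size V <= 6 * C)%N &
    {subset simplex_values m (cech iZ) S ++
      simplex_values m (cech iY) [fset phi x | x in S]%fset <= V}.
  move=> Sk; exists (simplex_values m (cech iZ) S ++
      simplex_values m (cech iY) [fset phi x | x in S]%fset) => //.
  rewrite size_cat !size_simplex_values (_ : 6 * C = 3 * C + 3 * C)%N; last by lia.
  by apply: leq_add; apply: sizeC; rewrite -Sk // leq_imfset_card.
move=> x y Xx Xy.
have qi := quasi_isometry_of_persistence m_gt0 mk (@cech_monotone R Z EZ iZ)
  (@cech_monotone R Y EY iY) edgeZ edgeY cov clo gb vals Xx Xy.
(* At most [3 * C] values on each side give the bound [12 * C * eps], again nonnegative. *)
have := le_trans (normr_ge0 _) qi; move: qi.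
rewrite natrM; move=> qi B0; apply: le_trans qi _; nra.
Qed.
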